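(* Let $Q$ be a directed graph, let $w=e_1e_2\cdots e_n$ be a finite path in $Q$, let $\lambda\in\overline{\mathbb{D}}$ and $\mu\in\mathbb{T}$. Then the map $\pi_{w,\lambda,\mu}$ defined on generators by $$\pi_{w,\lambda,\mu}(P_v)=\sum_{s(e_j)=v}e_{j,j}\quad (v\in V(Q)),\qquad \pi_{w,\lambda,\mu}(L_e)=\sum_{e_j=e}\lambda\, e_{j-1,j}\quad (e\in E(Q)),$$ where $e_{0,1}$ denotes the matrix $\mu e_{n,1}$, extends to a completely contractive representation of $\mathcal{T}^{+}(Q)$ into $M_n$. Moreover, if $w$ is a primitive cycle and $\lambda\neq 0$, then this extension is onto $M_n$.
   Context: A directed graph $Q$ has vertex set $V(Q)$, edge set $E(Q)$, and range and source maps $r,s:E(Q)\to V(Q)$. A finite path is a sequence $e_1e_2\cdots e_n$ of edges with $r(e_i)=s(e_{i-1})$ for $2\le i\le n$ (so its source is $s(e_n)$ and its range is $r(e_1)$); vertices are paths of length $0$. The path $w=e_1\cdots e_n$ is a cycle if $r(e_1)=s(e_n)$, and is primitive if it is not a proper power, i.e. $w\ne u^k$ for every path $u$ and $k\ge 2$. $\mathcal{T}^{+}(Q)$ is the norm closed operator algebra generated by the left regular representation of $Q$: on the Hilbert space with orthonormal basis $\{\xi_u\}$ indexed by all finite paths $u$ (including vertices), $L_e\xi_u=\xi_{eu}$ if $r(u)=s(e)$ and $0$ otherwise, and $P_v\xi_u=\xi_u$ if $r(u)=v$ and $0$ otherwise; $\mathcal{T}^{+}(Q)$ is generated by $\{P_v,L_e: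 v\in V(Q), e\in E(Q)\}$. $M_n$ is the algebra of complex $n\times n$ matrices, and $e_{i,j}\in M_n$ (with two indices) is the elementary matrix with $1$ in position $(i,j)$. $\mathbb{D}$ is the open unit disk, $\mathbb{T}$ the unit circle. A completely contractive representation is a completely contractive algebra homomorphism.
   Formalization: The first part is stated for w a cycle or λ=0: if w (n≥1) is not a cycle and λ≠0, the matrix of L_{e_1} has entry λμ≠0 at (n,1), but row n of the matrix of P_{r(e_1)} is 0, contradicting L_{e_1}=P_{r(e_1)}L_{e_1}. *)

(* Defs.v *)
From HB Require Import structures.
From mathcomp Require Export all_boot all_order all_algebra.
From mathcomp Require Export all_classical all_reals.
From mathcomp Require Export ereal esum complex.
From mathcomp Require Import ring.

Set Implicit Arguments.
Unset Strict Implicit.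
Unset Printing Implicit Defensive.

Import Order.TTheory GRing.Theory Num.Theory.
Import Normc.

Local Open Scope classical_set_scope.
Local Open Scope ring_scope.
Local Open Scope complex_scope.

Record digraph := Digraph {
  vertex : choiceType;
  edge : choiceType;
  rng : edge -> vertex;
  src : edge -> vertex
}.

Section Paths.
Variable Q : digraph.

Definition composable : rel (edge Q) := fun e f => rng f == src e.

(* The pair (v, [:: e_1; ...; e_n]) encodes the path e_1 ... e_n with source v,
   where r(e_i) = s(e_(i-1)): paths are read from right to left. The vertices
   are the paths (v, [::]). For n > 0 the second condition says v = s(e_n), so
   that v is redundant. *)
Definition is_path (p : vertex Q * seq (edge Q)) : bool :=
  sorted composable p.2 && (last p.1 [seq src e | e <- p.2] == p.1).

Definition fpath := {p : vertex Q * seq (edge Q) | is_path p}.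

Definition edges (p : fpath) : seq (edge Q) := (val p).2.
Definition plen (p : fpath) : nat := size (edges p).
Definition path_src (p : fpath) : vertex Q := (val p).1.
Definition path_rng (p : fpath) : vertex Q :=
  head (path_src p) [seq rng e | e <- edges p].

Definition is_cycle (p : fpath) : Prop := path_rng p = path_src p.

(* The edge list of u ^ k is the k-fold concatenation of that of u; when it is
   the edge list of a path, u ^ k is a path. *)
Definition primitive (w : fpath) : Prop :=
  forall (u : fpath) (k : nat), (2 <= k)%N ->
    edges w <> flatten (nseq k (edges u)).

Lemma cons_path_subproof (e : edge Q) (p : fpath) :
  path_rng p = src e -> is_path (path_src p, e :: edges p).
Proof.
have := valP p; rewrite /path_rng /edges /path_src /is_path.
case: (val p) => v [|f s] /andP[] /=; first by move=> _ _ ->; rewrite eqxx.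
by move=> fs /eqP -> rE; rewrite fs /composable rE !eqxx.
Qed.

Definition cons_path e p (h : path_rng p = src e) : fpath :=
  exist _ (path_src p, e :: edges p) (cons_path_subproof h).

(* [uncons_path e p] is [Some q] if p = e q, and [None] if p does not start
   with e. *)
Definition uncons_path (e : edge Q) (p : fpath) : option fpath :=
  if edges p is f :: s then
    if f == e then insub (path_src p, s) else None
  else None.

Lemma uncons_pathP e p q : uncons_path e p = Some q <->
  exists h : path_rng q = src e, p = cons_path h.
Proof.
rewrite /uncons_path; split; last first.
  move=> [h ->]; rewrite /edges /path_src /= eqxx.
  by rewrite -surjective_pairing valK.
case pE: (edges p) => [//|f s].
case: eqP => // fe; subst f; case: insubP => // q' q'P q'E [?]; subst q'.
have h : path_rng q = src e.
  have := valP p; rewrite /path_rng /edges /path_src /is_path q'E /=.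
  rewrite (pE : (val p).2 = e :: s) /=.
  by case: s {q'P q'E pE} => [/eqP //|g s /andP[/andP[/eqP]]].
exists h; apply: val_inj => /=; rewrite /path_src /edges q'E /=.
by rewrite -pE; exact: surjective_pairing.
Qed.

End Paths.

Section SquareSummable.
Variables (R : realType) (I : choiceType).

Lemma normc_ge0 (z : R[i]) : 0 <= normc z.
Proof. by case: z => a b; exact: sqrtr_ge0. Qed.

Definition sqsum (f : I -> R[i]) : \bar R :=
  (\esum_(i in [set: I]) (normc (f i) ^+ 2)%:E)%E.

Definition square_summable : {pred (I -> (R[i])^o)} :=
  fun f => `[< (sqsum f < +oo)%E >].

Lemma square_summableP f : reflect (sqsum f < +oo)%E (f \in square_summable).
Proof. exact: asboolP. Qed.

Lemma square_summable_submod_closed : submod_closed square_summable.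
Proof.
split=> [|a f g /square_summableP fP /square_summableP gP].
  apply/square_summableP; rewrite /sqsum esum1 ?ltry// => i _.
  by rewrite normc0 expr0n.
apply/square_summableP.
pose b i : \bar R := ((2 * normc a ^+ 2)%:E * (normc (f i) ^+ 2)%:E)%E.
pose c i : \bar R := (2%:E * (normc (g i) ^+ 2)%:E)%E.
have sqE0 (h : I -> R[i]) i : (0 <= (normc (h i) ^+ 2)%:E :> \bar R)%E.
  by rewrite lee_fin sqr_ge0.
have fin (k : R) (h : I -> R[i]) : 0 <= k -> (sqsum h < +oo)%E ->
    (\esum_(i in [set: I]) (k%:E * (normc (h i) ^+ 2)%:E)%E < +oo)%E.
  move=> k0 hP; apply: (@le_lt_trans _ _ (k%:E * sqsum h)%E); last first.
    exact: lte_mul_pinfty.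
  rewrite ge_ereal_sup => //= _ [X XI <-].
  rewrite -ge0_mule_fsumr//; apply: lee_wpmul2l; first by rewrite lee_fin.
  by apply: esum_ge; exists X.
apply: (@le_lt_trans _ _ (\esum_(i in [set: I]) (b i + c i)%E)%E).
  apply: le_esum => i _; rewrite /b /c -!EFinM -EFinD lee_fin.
  apply: (@le_trans _ _ ((normc a * normc (f i) + normc (g i)) ^+ 2)).
    rewrite ler_sqr ?nnegrE ?addr_ge0 ?mulr_ge0 ?normc_ge0//.
    by rewrite -normcM; exact: le_normcD.
  rewrite -mulrA -exprMn -mulrDr; move: (normc a * normc (f i)) (normc (g i)) => x y.
  rewrite sqrrD -subr_ge0 [X in _ <= X](_ : _ = (x - y) ^+ 2) ?sqr_ge0//.
  by rewrite sqrrB; ring.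
rewrite esumD//; last 2 first.
- by move=> i _; rewrite mule_ge0// lee_fin mulr_ge0// sqr_ge0.
- by move=> i _; rewrite mule_ge0// lee_fin.
by rewrite lte_add_pinfty// fin// mulr_ge0// sqr_ge0.
Qed.

HB.instance Definition _ :=
  GRing.isSubmodClosed.Build _ _ square_summable square_summable_submod_closed.

Definition l2 := {f : I -> (R[i])^o | f \in square_summable}.

HB.instance Definition _ := SubChoice.on l2.
HB.instance Definition _ := [SubChoice_isSubLmodule of l2 by <:].

Definition L2 f (h : f \in square_summable) : l2 :=
  exist (fun f => is_true (f \in square_summable)) f h.

Definition l2norm (x : l2) : R := Num.sqrt (fine (sqsum (val x))).

End SquareSummable.

(* If g : I -> option I is injective where defined, [pullback g f] is the
   family i |-> f (g i), extended by 0; it sends the basis vector at j to the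
   basis vector at the preimage of j, or to 0 if there is none. *)
Section Pullback.
Variables (R : realType) (I : choiceType).

Lemma basis_subproof (i : I) :
  (fun j => (j == i)%:R : (R[i])^o) \in @square_summable R I.
Proof.
apply/square_summableP; rewrite /sqsum.
rewrite (_ : (\esum_(j in _) _)%E =
  (\esum_(j in [set: I]) if j \in [set i] then 1%:E else 0)%E).
  by rewrite -esum_mkcond esum_set1 ?ltry// lee_fin.
apply: eq_esum => j _; case: eqVneq => [->|ji].
  by rewrite mem_set// normc1 expr1n.
by rewrite memNset ?normc0 ?expr0n//= => /eqP; rewrite (negbTE ji).
Qed.

Definition basis (i : I) : l2 R I := L2 (basis_subproof i).

Variable g : I -> option I.
Hypothesis g_inj : forall i j k, g i = Some k -> g j = Some k -> i = j.

Let pullback_fun (f : I -> R[i]) (i : I) : (R[i])^o :=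
  if g i is Some j then f j else 0.

Lemma sqsum_pullback_le (f : I -> R[i]) : (sqsum (pullback_fun f) <= sqsum f)%E.
Proof.
rewrite /sqsum /pullback_fun.
pose D := [set i | g i != None]; pose h i := odflt i (g i).
have hinj : set_inj D h.
  move=> i j; rewrite !inE /D /h /=.
  case gi: (g i) => [k|//] _; case gj: (g j) => [l|//] _ /= kl.
  by subst l; apply: g_inj gi gj.
apply: (@le_trans _ _ (\esum_(j in h @` D) (normc (f j) ^+ 2)%:E)%E).
  rewrite (esum_image D h)// [leRHS]esum_mkcond; apply: le_esum => i _.
  rewrite /h; case: ifPn; rewrite ?inE ?notin_setE /D /=; case: (g i) => //=.
  by rewrite expr0n /= addr0 sqrtr0 expr0n.
rewrite esum_mkcond; apply: le_esum => i _.
by case: ifP => // _; rewrite lee_fin sqr_ge0.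
Qed.

Lemma pullback_subproof (f : l2 R I) :
  pullback_fun (val f) \in @square_summable R I.
Proof.
apply/square_summableP; apply: le_lt_trans (sqsum_pullback_le _) _.
by have /square_summableP := valP f.
Qed.

Definition pullback (f : l2 R I) : l2 R I := L2 (pullback_subproof f).

Lemma pullback_basis_Some i j : g i = Some j -> pullback (basis j) = basis i.
Proof.
move=> gi; apply: val_inj; apply/funext => k /=; rewrite /pullback_fun.
have [->|ki] := eqVneq k i; first by rewrite gi eqxx.
case gk: (g k) => [l|//]; case: eqVneq => // lj; subst l.
by move: ki; rewrite (g_inj gk gi) eqxx.
Qed.

Lemma pullback_basis_None j :
  (forall i, g i <> Some j) -> pullback (basis j) = 0.
Proof.
move=> gj; apply: val_inj; apply/funext => k /=; rewrite /pullback_fun.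
by case gk: (g k) => [l|//]; case: eqVneq => // lj; case: (gj k); rewrite gk lj.
Qed.

End Pullback.

Section LeftRegular.
Variables (R : realType) (Q : digraph).

Definition fock := l2 R (fpath Q).

Definition xi (u : fpath Q) : fock := basis R u.

Lemma uncons_path_inj e (p q u : fpath Q) :
  uncons_path e p = Some u -> uncons_path e q = Some u -> p = q.
Proof.
move=> /uncons_pathP[h ->] /uncons_pathP[h' ->].
by apply: val_inj.
Qed.

Definition L_ (e : edge Q) : fock -> fock := pullback (@uncons_path_inj e).

Definition with_range (v : vertex Q) (p : fpath Q) : option (fpath Q) :=
  if path_rng p == v then Some p else None.

Lemma with_range_inj v (p q u : fpath Q) :
  with_range v p = Some u -> with_range v q = Some u -> p = q.
Proof. by rewrite /with_range; case: eqP => // _ [->]; case: eqP => // _ []. Qed.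

Definition P_ (v : vertex Q) : fock -> fock := pullback (@with_range_inj v).

Lemma L_xi e u (h : path_rng u = src e) : L_ e (xi u) = xi (cons_path h).
Proof. by apply: pullback_basis_Some; apply/uncons_pathP; exists h. Qed.

Lemma L_xi0 e u : path_rng u != src e -> L_ e (xi u) = 0.
Proof.
move=> /eqP ue; apply: pullback_basis_None => p /uncons_pathP[h _].
exact: ue.
Qed.

Lemma P_xi v u : P_ v (xi u) = if path_rng u == v then xi u else 0.
Proof.
case: eqP => uv.
  by apply: pullback_basis_Some; rewrite /with_range uv eqxx.
apply: pullback_basis_None => p; rewrite /with_range.
by case: eqP => // pv [pu]; apply: uv; rewrite -pu.
Qed.

End LeftRegular.

Arguments P_ R {Q} v.
Arguments L_ R {Q} e.

Section OperatorNorm.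
Variable R : realType.

(* The supremum of nV (T x) over the unit ball of nU, possibly +oo; it is the
   operator norm when T is linear. *)
Definition opnorm (U V : Type) (nU : U -> R) (nV : V -> R) (T : U -> V) :
    \bar R :=
  ereal_sup [set (nV (T x))%:E | x in [set x | nU x <= 1]].

Definition vnorm n (x : 'cV[R[i]]_n) : R :=
  Num.sqrt (\sum_(i < n) normc (x i 0) ^+ 2).

(* The norm of the Hilbert space direct sum of k copies of U. *)
Definition dsum_norm (U : Type) (nU : U -> R) k (x : 'I_k -> U) : R :=
  Num.sqrt (\sum_(i < k) nU (x i) ^+ 2).

(* The map from U^k to V^k given by a k x k matrix of maps from U to V. *)
Definition mxact (U V : nmodType) k (A : 'M[U -> V]_k) (x : 'I_k -> U) :
    'I_k -> V :=
  fun i => \sum_(j < k) A i j (x j).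

Definition mx_opnorm (U V : nmodType) (nU : U -> R) (nV : V -> R) k
    (A : 'M[U -> V]_k) : \bar R :=
  opnorm (@dsum_norm _ nU k) (@dsum_norm _ nV k) (mxact A).

Definition mxmx_norm n k (B : 'M['M[R[i]]_n]_k) : \bar R :=
  mx_opnorm (@vnorm n) (@vnorm n)
    (map_mx (fun b : 'M_n => (fun x : 'cV_n => b *m x)) B).

End OperatorNorm.

Section TensorAlgebra.
Variables (R : realType) (Q : digraph).
Local Notation H := (fock R Q).
Local Notation norm := (@l2norm R (fpath Q)).

(* The identity is not a generator: with infinitely many vertices the algebra is
   not unital. *)
Inductive gen_alg : set (H -> H) :=
| gen_P v : gen_alg (P_ R v)
| gen_L e : gen_alg (L_ R e)
| gen_0 : gen_alg 0
| gen_add S T : gen_alg S -> gen_alg T -> gen_alg (S + T)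
| gen_scale (c : R[i]) S : gen_alg S -> gen_alg (c *: S)
| gen_comp S T : gen_alg S -> gen_alg T -> gen_alg (S \o T).

Definition bounded_op (T : H -> H) : Prop :=
  linear T /\ (opnorm norm norm T < +oo)%E.

Definition tensor_alg : set (H -> H) :=
  [set T | bounded_op T /\
    forall eps : R, 0 < eps ->
      exists2 S, gen_alg S & (opnorm norm norm (T - S)%R < eps%:E)%E].

(* Only the values of phi on A matter. *)
Record cc_representation (A : set (H -> H)) n (phi : (H -> H) -> 'M[R[i]]_n) :
    Prop := CCRepresentation {
  repD : forall S T, A S -> A T -> phi (S + T) = phi S + phi T;
  repZ : forall (c : R[i]) S, A S -> phi (c *: S) = c *: phi S;
  repM : forall S T, A S -> A T -> phi (S \o T) = phi S *m phi T;
  rep_cc : forall k (M : 'M[H -> H]_k), (forall i j, A (M i j)) ->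
    (mxmx_norm (map_mx phi M) <= mx_opnorm norm norm M)%E
}.

End TensorAlgebra.

Arguments tensor_alg : clear implicits.

Section PathRepresentation.
Variables (R : realType) (Q : digraph) (w : fpath Q) (lambda mu : R[i]).
Local Notation n := (plen w).

(* Indices start at 0: [nth_edge j] is e_(j+1). *)
Definition nth_edge (j : 'I_n) : edge Q := tnth (in_tuple (edges w)) j.

Definition pi_P (v : vertex Q) : 'M[R[i]]_n :=
  \sum_(j < n | src (nth_edge j) == v) delta_mx j j.

(* The matrix e_(j-1,j), with e_(0,1) := mu e_(n,1); [ord_pred] is the cyclic
   predecessor, so it sends the first index to the last one. *)
Definition shift_unit (j : 'I_n) : 'M[R[i]]_n :=
  if val j == 0%N then mu *: delta_mx (ord_pred j) j
  else delta_mx (ord_pred j) j.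

Definition pi_L (e : edge Q) : 'M[R[i]]_n :=
  \sum_(j < n | nth_edge j == e) lambda *: shift_unit j.

End PathRepresentation.

Arguments pi_P R {Q} w v.
Arguments pi_L {R Q} w lambda mu e.

(* Main.v *)
Require Import Defs.
From HB Require Import structures.
From mathcomp Require Import ring lra filter.

Set Implicit Arguments.
Unset Strict Implicit.
Unset Printing Implicit Defensive.

Import Order.TTheory GRing.Theory Num.Theory.
Import Normc.

Local Open Scope classical_set_scope.
Local Open Scope ring_scope.
Local Open Scope complex_scope.

(** Write n for the length of w, b_1, ..., b_n for the standard basis of C^n and
    H for the Fock space of Q. Suppose first that w is a cycle. From the
    position i one can walk along w, with indices read modulo n: the first m
    steps form the path e_(i+1) ... e_(i+m). Consider the vectors

      V_N b_i = c_N \sum_(m < N) conj(gamma_(i,m)) xi_(p(i,m)) (x) b_(i+m)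

    of H (x) C^n, where p(i,m) = e_(i+1) ... e_(i+m), gamma_(i,m) is the product of the m coefficients that
    pi_(w,lambda,mu) attaches to the edges of the walk, so that its modulus is
    |lambda|^m, and c_N^-2 = \sum_(m < N) |lambda|^(2m). The 2nd tensor factor and
    the length of the path recover i, hence V_N is an isometry. Put F_N = V_N^*.
    Removing the first edge of a walk from i gives the walk from i+1, so that

      F_N (L_e (x) 1) = pi(L_e) F_N

    up to the term in which the walk reaches the length N, and exactly the same
    holds without an error for P_v. The error has norm at most
    c_N |lambda|^N, and its square is at most 1/N since |lambda| <= 1, also on
    the unit circle. If lambda = 0, only m = 0 contributes and the walks along w
    are not needed: then N = 1 gives an exact intertwining for any path w.

    Maps F_N with such properties always produce a completely contractive
    representation ([asymptotic_compression]). Call T and a matrix M intertwined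
    if F_N (T (x) 1) - M F_N tends to 0 in norm. This relation is compatible with
    sums, multiples and products; M is determined by T, because the F_N are onto;
    and it extends from the generators to the norm closure of the algebra they
    generate, because matrices intertwined with close operators are close. The
    resulting map T |-> M is a completely contractive homomorphism, since M is
    a limit of the compressions F_N (T (x) 1) V_N and F_N, V_N are contractions.
    Finite sums and limits are used, rather than the infinite walks that are
    available when |lambda| < 1, in order to treat all lambda at once.

    For surjectivity, the product of the matrices of the edges met in a full
    turn from i is a combination of the units e_(j,j) such that w read
    from j is the same word as w read from i. When w is primitive, only j = i has
    this property ([primitive_aperiodic]); if also lambda <> 0, the image contains
    e_(i,i). Multiplying by the matrices of edges then moves e_(i,i) to
    every e_(i,j). *)

(** * Square summable families *)

Section ComplexModulus.
Variable R : realType.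
Implicit Types a b z : R[i].

Lemma normc_real (t : R) : 0 <= t -> normc t%:C = t.
Proof. by move=> t0; rewrite /normc /= expr0n /= addr0 sqrtr_sqr ger0_norm. Qed.

Lemma normc_conj z : normc (z^*)%C = normc z.
Proof. by case: z => a b; rewrite /normc /= sqrrN. Qed.

Lemma normcB_le a b : normc (a - b) <= normc a + normc b.
Proof. by rewrite -(normcN b) le_normcD. Qed.

Lemma normcD_sqr_le a b :
  normc (a + b) ^+ 2 <= 2 * (normc a ^+ 2 + normc b ^+ 2).
Proof.
have := le_normcD a b; have := normc_ge0 (a + b).
move: (normc (a + b)) (normc a) (normc b) => x y z x0 xyz.
have := sqr_ge0 (y - z); nra.
Qed.

Lemma normc_Re_le z : `|complex.Re z| <= normc z.
Proof.
case: z => a b; rewrite /normc /= -sqrtr_sqr ler_sqrt ?addr_ge0 ?sqr_ge0//.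
by rewrite lerDl sqr_ge0.
Qed.

Lemma normc_Im_le z : `|complex.Im z| <= normc z.
Proof.
case: z => a b; rewrite /normc /= -sqrtr_sqr ler_sqrt ?addr_ge0 ?sqr_ge0//.
by rewrite lerDr sqr_ge0.
Qed.

Lemma normc_le_ReIm z : normc z <= `|complex.Re z| + `|complex.Im z|.
Proof.
case: z => a b; rewrite -ler_sqr ?nnegrE ?normc_ge0 ?addr_ge0//=.
rewrite sqr_sqrtr ?addr_ge0 ?sqr_ge0// sqrrD !real_normK ?num_real//.
by rewrite -addrA (addrC (_ *+ 2)) addrA lerDl mulrn_wge0// mulr_ge0.
Qed.

End ComplexModulus.

Section SquareSummableNorm.
Variables (R : realType) (I : choiceType).
Implicit Types x y : l2 R I.

Lemma sqsumE x : sqsum (val x) = (l2norm x ^+ 2)%:E.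
Proof.
have s0 : (0 <= sqsum (val x))%E.
  by apply: esum_ge0 => i _; rewrite lee_fin sqr_ge0.
have /square_summableP xP := valP x.
by rewrite /l2norm sqr_sqrtr ?fine_ge0// fineK// ge0_fin_numE.
Qed.

Lemma l2norm_ge0 x : 0 <= l2norm x.
Proof. exact: sqrtr_ge0. Qed.

(** Together with [l2norm_sqr_le], this reduces every statement about the l2
    norm to sums over finite duplicate-free sequences of indices. *)
Lemma Bessel_seq (s : seq I) x : uniq s ->
  \sum_(i <- s) normc (val x i) ^+ 2 <= l2norm x ^+ 2.
Proof.
move=> us; rewrite -lee_fin -sqsumE -sumEFin.
by apply: esum_ge; exists [set` s]; [split | rewrite -fsbig_seq].
Qed.

Lemma l2norm_sqr_le x (C : R) :
  (forall s, uniq s -> \sum_(i <- s) normc (val x i) ^+ 2 <= C) ->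
  l2norm x ^+ 2 <= C.
Proof.
move=> xC; rewrite -lee_fin -sqsumE; apply: ge_ereal_sup => _ [X [finX _] <-].
by rewrite fsbig_finite//= sumEFin lee_fin xC.
Qed.

Lemma Bessel_ord N (q : 'I_N -> I) x : injective q ->
  \sum_(m < N) normc (val x (q m)) ^+ 2 <= l2norm x ^+ 2.
Proof.
move=> qinj; rewrite -(big_enum _ _ xpredT) /=.
have := @Bessel_seq [seq q m | m <- enum 'I_N] x.
by rewrite big_map; apply; rewrite map_inj_uniq ?enum_uniq.
Qed.

Lemma normc_le_l2norm x i : normc (val x i) <= l2norm x.
Proof.
rewrite -ler_sqr ?nnegrE ?normc_ge0 ?l2norm_ge0//.
by have := @Bessel_seq [:: i] x; rewrite big_seq1; apply.
Qed.

Lemma l2norm0 : l2norm (0 : l2 R I) = 0.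
Proof.
apply/eqP; rewrite -sqrf_eq0 eq_le sqr_ge0 andbT.
by apply: l2norm_sqr_le => s _; rewrite big1// => i _; rewrite normc0 expr0n.
Qed.

Lemma l2normZ_le (c : R[i]) x : l2norm (c *: x) <= normc c * l2norm x.
Proof.
rewrite -ler_sqr ?nnegrE ?mulr_ge0 ?normc_ge0 ?l2norm_ge0//.
apply: l2norm_sqr_le => s us; rewrite exprMn.
apply: le_trans (ler_wpM2l (sqr_ge0 _) (Bessel_seq x us)).
rewrite mulr_sumr; apply: ler_sum => i _.
by rewrite /= normcM exprMn.
Qed.

(** A substitute for the triangle inequality: it is only needed to see that sums
    of bounded operators are bounded. *)
Lemma l2norm_sqrD_le x y :
  l2norm (x + y) ^+ 2 <= 2 * (l2norm x ^+ 2 + l2norm y ^+ 2).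
Proof.
apply: l2norm_sqr_le => s us.
apply: (@le_trans _ _ (2 * (\sum_(i <- s) normc (val x i) ^+ 2 +
                            \sum_(i <- s) normc (val y i) ^+ 2))).
  rewrite -big_split mulr_sumr; apply: ler_sum => i _.
  exact: normcD_sqr_le.
by rewrite ler_wpM2l// lerD// Bessel_seq.
Qed.

(** One half of Pythagoras for an orthonormal family of basis vectors. *)
Lemma l2norm_sum_basis_le N (q : 'I_N -> I) (a : 'I_N -> R[i]) :
  injective q ->
  l2norm (\sum_(m < N) a m *: basis R (q m)) ^+ 2
    <= \sum_(m < N) normc (a m) ^+ 2.
Proof.
move=> qinj; apply: l2norm_sqr_le => s us.
have valE i : val (\sum_(m < N) a m *: basis R (q m)) i =
    \sum_(m < N) a m * (i == q m)%:R.
  rewrite raddf_sum /=.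
  by elim/big_rec2: _ => // m y1 y2 _ <-.
apply: (@le_trans _ _
   (\sum_(i <- s) \sum_(m < N) normc (a m) ^+ 2 * (i == q m)%:R)).
  apply: ler_sum => i _; rewrite valE.
  have [[m0 ->]|no] := pselect (exists m, i = q m).
    rewrite (bigD1 m0)//= big1 ?addr0 ?eqxx ?mulr1; last first.
      by move=> m; rewrite eq_sym (inj_eq qinj) => /negbTE ->; rewrite mulr0.
    rewrite (bigD1 m0)//= eqxx mulr1 lerDl sumr_ge0// => m _.
    by rewrite mulr_ge0 ?sqr_ge0.
  rewrite big1 => [|m _].
    rewrite normc0 expr0n /= sumr_ge0// => m _.
    by rewrite mulr_ge0 ?sqr_ge0.
  by case: eqP => [iE|]; [case: no; exists m|rewrite mulr0].
rewrite exchange_big /=; apply: ler_sum => m _.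
rewrite -mulr_sumr ler_piMr ?sqr_ge0// -natr_sum lern1.
rewrite -(big_map (fun i => nat_of_bool (i == q m)) xpredT id) -sumnE sumn_count.
by rewrite count_uniq_mem// leq_b1.
Qed.

Lemma l2norm_pullback_le (g : I -> option I)
    (g_inj : forall i j k, g i = Some k -> g j = Some k -> i = j) x :
  l2norm (pullback g_inj x) <= l2norm x.
Proof.
rewrite -ler_sqr ?nnegrE ?l2norm_ge0// -lee_fin -!sqsumE.
exact: (@sqsum_pullback_le R I g).
Qed.

Lemma pullback_linear (g : I -> option I)
    (g_inj : forall i j k, g i = Some k -> g j = Some k -> i = j) :
  linear (pullback (R := R) g_inj).
Proof.
move=> a x y; apply: val_inj; apply/funext => i.
pose G (z : l2 R I) : R[i] := if g i is Some j then val z j else 0.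
rewrite -[LHS]/(G (a *: x + y)) -[RHS]/(a * G x + G y) /G.
by case: (g i) => [j//|]; rewrite mulr0 addr0.
Qed.

End SquareSummableNorm.

(** * Bounded operators on the Fock space *)

Lemma linear_scale (K : pzRingType) (U V : lmodType K) (T : U -> V) :
  linear T -> forall a u, T (a *: u) = a *: T u.
Proof.
move=> linT a u; have T0 : T 0 = 0.
  by have := linT (-1) 0 0; rewrite scaler0 addr0 scaleN1r addNr.
by have := linT a u 0; rewrite T0 !addr0.
Qed.

Section OperatorBounds.
Variable R : realType.

(** By homogeneity it suffices to know T on the unit ball. Vectors are scaled by
    numbers slightly larger than their norm, so that those of norm 0 are no
    exception. *)
Lemma opnorm_bound (U V : lmodType R[i]) (nU : U -> R) (nV : V -> R)
    (T : U -> V) (C : R) :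
  (forall x, 0 <= nU x) ->
  (forall t x, 0 < t -> nU (t%:C *: x) <= t * nU x) ->
  (forall t x, 0 < t -> nV (t%:C *: x) <= t * nV x) ->
  (forall t x, T (t%:C *: x) = t%:C *: T x) ->
  0 <= C -> (opnorm nU nV T <= C%:E)%E -> forall x, nV (T x) <= C * nU x.
Proof.
move=> nU0 nUZ nVZ TZ C0 TC x; apply/ler_addgt0Pr => e e0.
(* Scaling by a number s slightly larger than the norm of x costs at most
   C * e / (C + 1) <= e. *)
pose s := nU x + e / (C + 1).
have C1 : 0 < C + 1 by rewrite ltr_wpDl.
have s0 : 0 < s by rewrite ltr_wpDl// divr_gt0.
have xE : x = s%:C *: (s^-1%:C *: x).
  by rewrite scalerA -rmorphM /= mulfV ?lt0r_neq0// scale1r.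
have le1 : nU (s^-1%:C *: x) <= 1.
  apply: le_trans (nUZ _ _ _) _; first by rewrite invr_gt0.
  by rewrite mulrC ler_pdivrMr// mul1r lerDl divr_ge0// ltW.
have TsC : nV (T (s^-1%:C *: x)) <= C.
  rewrite -lee_fin; apply: le_trans TC; apply: ereal_sup_ubound.
  by exists (s^-1%:C *: x).
rewrite [in leLHS]xE TZ; apply: le_trans (nVZ _ _ s0) _.
apply: le_trans (ler_wpM2l (ltW s0) TsC) _.
rewrite mulrC mulrDr lerD2l mulrCA ler_piMr ?(ltW e0)//.
by rewrite ler_pdivrMr// mul1r lerDl.
Qed.

Lemma opnorm_le (U V : Type) (nU : U -> R) (nV : V -> R) (T : U -> V) (C : R) :
  0 <= C -> (forall x, nV (T x) <= C * nU x) -> (opnorm nU nV T <= C%:E)%E.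
Proof.
move=> C0 TC; apply: ge_ereal_sup => _ [x /= x1 <-]; rewrite lee_fin.
by apply: le_trans (TC x) _; rewrite ler_piMr.
Qed.

Lemma dsum_norm_ge0 (U : Type) (nU : U -> R) k (x : 'I_k -> U) :
  0 <= dsum_norm nU x.
Proof. exact: sqrtr_ge0. Qed.

Lemma dsum_norm_sqr (U : Type) (nU : U -> R) k (x : 'I_k -> U) :
  dsum_norm nU x ^+ 2 = \sum_(i < k) nU (x i) ^+ 2.
Proof. by rewrite sqr_sqrtr// sumr_ge0// => i _; rewrite sqr_ge0. Qed.

Lemma le_dsum_norm (U V : Type) (nU : U -> R) (nV : V -> R) k
    (x : 'I_k -> U) (y : 'I_k -> V) (C : R) : 0 <= C ->
  (forall i, 0 <= nU (x i)) -> (forall i, nU (x i) <= C * nV (y i)) ->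
  dsum_norm nU x <= C * dsum_norm nV y.
Proof.
move=> C0 nU0 xy.
rewrite -ler_sqr ?nnegrE ?mulr_ge0 ?dsum_norm_ge0//.
rewrite exprMn !dsum_norm_sqr mulr_sumr; apply: ler_sum => i _.
have C0y : 0 <= C * nV (y i) by apply: le_trans (xy i).
by rewrite -exprMn ler_sqr ?nnegrE.
Qed.

Lemma le_dsum_norm_coord (U : Type) (nU : U -> R) k (x : 'I_k -> U) i :
  (forall u, 0 <= nU u) -> nU (x i) <= dsum_norm nU x.
Proof.
move=> nU0; rewrite -ler_sqr ?nnegrE ?dsum_norm_ge0// dsum_norm_sqr.
by rewrite (bigD1 i)//= lerDl sumr_ge0// => j _; rewrite sqr_ge0.
Qed.

Lemma vnorm_ge0 n (y : 'cV[R[i]]_n) : 0 <= vnorm y.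
Proof. exact: sqrtr_ge0. Qed.

Lemma vnorm_sqr n (y : 'cV[R[i]]_n) :
  vnorm y ^+ 2 = \sum_(i < n) normc (y i 0) ^+ 2.
Proof. by rewrite sqr_sqrtr// sumr_ge0// => i _; rewrite sqr_ge0. Qed.

Lemma normc_le_vnorm n (y : 'cV[R[i]]_n) i : normc (y i 0) <= vnorm y.
Proof.
rewrite -ler_sqr ?nnegrE ?vnorm_ge0 ?normc_ge0// vnorm_sqr.
by rewrite (bigD1 i)//= lerDl sumr_ge0// => j _; rewrite sqr_ge0.
Qed.

Lemma l2norm_realZ (I : choiceType) (t : R) (x : l2 R I) :
  0 < t -> l2norm (t%:C *: x) <= t * l2norm x.
Proof. by move=> /ltW t0; rewrite -{2}(normc_real t0) l2normZ_le. Qed.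

End OperatorBounds.

Section GeneratedAlgebra.
Variables (R : realType) (Q : digraph).
Local Notation H := (fock R Q).

Lemma op_bound (T : H -> H) (C : R) : linear T -> 0 <= C ->
  (opnorm (@l2norm R _) (@l2norm R _) T <= C%:E)%E ->
  forall x, l2norm (T x) <= C * l2norm x.
Proof.
move=> linT C0 TC; apply: opnorm_bound => //.
- exact: l2norm_ge0.
- exact: l2norm_realZ.
- exact: l2norm_realZ.
- by move=> t x; rewrite linear_scale.
Qed.

Lemma bounded_opP (T : H -> H) : bounded_op T <->
  linear T /\ exists2 C, 0 <= C & forall x, l2norm (T x) <= C * l2norm x.
Proof.
split=> -[linT TC]; split=> //; last first.
  by case: TC => C C0 /(opnorm_le C0) /le_lt_trans; apply; rewrite ltry.
move: TC; case E: (opnorm _ _ _) => [c| |]// _.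
  exists (Num.max c 0); first by rewrite le_max lexx orbT.
  apply: op_bound => //; first by rewrite le_max lexx orbT.
  by rewrite E lee_fin le_max lexx.
by exists 0 => //; apply: op_bound => //; rewrite E leNye.
Qed.

Lemma gen_alg_bounded (S : H -> H) : gen_alg S -> bounded_op S.
Proof.
move=> genS; apply/bounded_opP; elim: genS => {S}.
- move=> v; split; first exact: pullback_linear.
  by exists 1 => // x; rewrite mul1r l2norm_pullback_le.
- move=> e; split; first exact: pullback_linear.
  by exists 1 => // x; rewrite mul1r l2norm_pullback_le.
- split=> [a x y|]; first by rewrite scaler0 addr0.
  by exists 0 => // x; rewrite mul0r l2norm0.
- move=> S T _ [linS [C C0 SC]] _ [linT [D D0 TD]]; split.
    move=> a x y; rewrite -[LHS]/(S (a *: x + y) + T (a *: x + y)).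
    by rewrite linS linT -[(S + T) x]/(S x + T x) scalerDr addrACA.
  exists (2 * (C + D)) => [|x]; first by rewrite mulr_ge0 ?addr_ge0.
  rewrite -ler_sqr ?nnegrE ?mulr_ge0 ?addr_ge0 ?l2norm_ge0//.
  apply: le_trans (l2norm_sqrD_le _ _) _.
  have := SC x; have := TD x; have := l2norm_ge0 x.
  have := l2norm_ge0 (S x); have := l2norm_ge0 (T x).
  move: (l2norm (S x)) (l2norm (T x)) (l2norm x) => s t r t0 s0 r0 tD sC.
  have s2 : s ^+ 2 <= (C * r) ^+ 2 by rewrite ler_sqr ?nnegrE ?mulr_ge0.
  have t2 : t ^+ 2 <= (D * r) ^+ 2 by rewrite ler_sqr ?nnegrE ?mulr_ge0.
  have Cr0 : 0 <= C * r by rewrite mulr_ge0.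
  have Dr0 : 0 <= D * r by rewrite mulr_ge0.
  rewrite -mulrA mulrDl; move: (C * r) (D * r) Cr0 Dr0 s2 t2 => c d; nra.
- move=> c S _ [linS [C C0 SC]]; split.
    move=> a x y; rewrite -[LHS]/(c *: S (a *: x + y)) linS.
    by rewrite -[(c *: S) x]/(c *: S x) scalerDr !scalerA mulrC.
  exists (normc c * C) => [|x]; first by rewrite mulr_ge0 ?normc_ge0.
  apply: le_trans (l2normZ_le _ _) _.
  by rewrite -mulrA ler_wpM2l ?normc_ge0.
- move=> S T _ [linS [C C0 SC]] _ [linT [D D0 TD]]; split.
    by move=> a x y; rewrite /= linT linS.
  exists (C * D) => [|x]; first by rewrite mulr_ge0.
  by apply: le_trans (SC _) _; rewrite -mulrA ler_wpM2l.
Qed.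

Lemma gen_alg_tensor (S : H -> H) : gen_alg S -> tensor_alg R Q S.
Proof.
move=> genS; split; first exact: gen_alg_bounded.
move=> eps eps0; exists S => //; rewrite subrr.
apply: (@le_lt_trans _ _ (0%:E)%E); last by rewrite lte_fin.
by apply: opnorm_le => // x; rewrite mul0r l2norm0.
Qed.

End GeneratedAlgebra.

(** * Compressions that intertwine asymptotically *)

Section NestedBalls.
Variable R : realType.

(** Completeness for an arbitrary family of approximations m, each with
    an error bound d: the supremum of the lower bounds m - d lies in
    all the intervals. *)
Lemma nested_intervals (P : R -> R -> Prop) :
  (exists m d, P m d) ->
  (forall m d m' d', P m d -> P m' d' -> m - m' <= d + d') ->
  exists L, forall m d, P m d -> `|L - m| <= d.
Proof.
move=> [m0 [d0 P0]] Pd.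
pose A := [set t | exists m d, P m d /\ t = m - d].
have A0 : A !=set0 by exists (m0 - d0), m0, d0.
have Aub m d : P m d -> ubound A (m + d).
  by move=> Pm _ [m' [d' [Pm' ->]]]; have := Pd _ _ _ _ Pm' Pm; lra.
have supA : has_sup A by split=> //; exists (m0 + d0); exact: Aub P0.
exists (sup A) => m d Pm.
have h1 : m - d <= sup A by apply: ub_le_sup; [case: supA | exists m, d].
have h2 : sup A <= m + d by apply: ge_sup => //; exact: Aub.
by rewrite ler_distl; apply/andP; split; lra.
Qed.

(** The complex version loses a factor 2 by treating real and imaginary parts
    separately. *)
Lemma nested_balls (P : R[i] -> R -> Prop) :
  (exists z d, P z d) ->
  (forall z d z' d', P z d -> P z' d' -> normc (z - z') <= d + d') ->
  exists L, forall z d, P z d -> normc (L - z) <= d + d.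
Proof.
move=> [z0 [d0 P0]] Pd.
have [||a aP] := @nested_intervals (fun m d => exists z, P z d /\ m = complex.Re z).
- by exists (complex.Re z0), d0, z0.
- move=> m d m' d' [z [Pz ->]] [z' [Pz' ->]].
  apply: le_trans (Pd _ _ _ _ Pz Pz'); apply: le_trans (normc_Re_le _).
  by rewrite raddfB /= ler_norm.
have [||b bP] := @nested_intervals (fun m d => exists z, P z d /\ m = complex.Im z).
- by exists (complex.Im z0), d0, z0.
- move=> m d m' d' [z [Pz ->]] [z' [Pz' ->]].
  apply: le_trans (Pd _ _ _ _ Pz Pz'); apply: le_trans (normc_Im_le _).
  by rewrite raddfB /= ler_norm.
exists (a +i* b) => z d Pz; apply: le_trans (normc_le_ReIm _) _.
rewrite !raddfB /= lerD//; [apply: aP | apply: bP]; by exists z.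
Qed.

End NestedBalls.

Section AsymptoticCompression.
Variables (R : realType) (Q : digraph) (n : nat).
Local Notation H := (fock R Q).
Local Notation norm := (@l2norm R (fpath Q)).
Local Notation dnorm := (@dsum_norm R H norm n).
Implicit Types (S T : H -> H) (M : 'M[R[i]]_n) (x : 'I_n -> H).

Variables (F : nat -> {linear ('I_n -> H) -> 'cV[R[i]]_n})
          (V : nat -> 'cV[R[i]]_n -> 'I_n -> H).
Hypotheses (F_contr : forall N x, vnorm (F N x) <= dnorm x)
           (FV : forall N y, F N (V N y) = y)
           (V_contr : forall N y, dnorm (V N y) <= vnorm y).

(** The operators act on H^n by [T \o x], that is, as T (x) 1 on H (x) C^n. *)
Definition intertwines T M := forall eps : R, 0 < eps ->
  \forall N \near \oo, forall x i,
    normc ((F N (T \o x) - M *m F N x) i 0) <= eps * dnorm x.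

Definition opdist_le T S (d : R) := forall u, norm (T u - S u) <= d * norm u.

Lemma normc_F_le N x i : normc (F N x i 0) <= dnorm x.
Proof. exact: le_trans (normc_le_vnorm _ _) (F_contr _ _). Qed.

Lemma normc_F_opdist_le N x i T S d : 0 <= d -> opdist_le T S d ->
  normc ((F N (T \o x) - F N (S \o x)) i 0) <= d * dnorm x.
Proof.
move=> d0 TS; rewrite -linearB; apply: le_trans (normc_F_le _ _ _) _.
by apply: le_dsum_norm => // c; [exact: l2norm_ge0 | exact: TS].
Qed.

Lemma normc_mulmx_le M (y : 'cV_n) (b d : R) i :
  (forall j, normc (M i j) <= b) -> (forall j, normc (y j 0) <= d) ->
  normc ((M *m y) i 0) <= n%:R * (b * d).
Proof.
move=> Mb yd; rewrite mxE.
apply: (@le_trans _ _ (\sum_(j < n) normc (M i j * y j 0))).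
  elim/big_rec2: _ => [|j s t _ ts]; first by rewrite normc0.
  by apply: le_trans (le_normcD _ _) _; rewrite lerD2l.
rewrite -[leRHS](_ : \sum_(j < n) b * d = _); last first.
  by rewrite sumr_const card_ord mulr_natl.
by apply: ler_sum => j _; rewrite normcM ler_pM ?normc_ge0.
Qed.

Lemma intertwinesD S T M M' :
  intertwines S M -> intertwines T M' -> intertwines (S + T) (M + M').
Proof.
move=> SM TM e e0; have e2 : 0 < e / 2 by rewrite divr_gt0.
apply: filterS2 (SM _ e2) (TM _ e2) => N SN TN x i.
rewrite (_ : F N ((S + T) \o x) = F N (S \o x) + F N (T \o x)); last first.
  by rewrite -linearD.
rewrite mulmxDl opprD addrACA mxE.
apply: le_trans (le_normcD _ _) _; rewrite [e]splitr mulrDl.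
by apply: lerD; [exact: SN | exact: TN].
Qed.

Lemma intertwinesZ (c : R[i]) T M :
  intertwines T M -> intertwines (c *: T) (c *: M).
Proof.
move=> TM e e0.
have c1 : 0 < normc c + 1 by rewrite ltr_wpDl ?normc_ge0.
apply: filterS (TM _ (divr_gt0 e0 c1)) => N TN x i.
rewrite (_ : F N ((c *: T) \o x) = c *: F N (T \o x)); last by rewrite -linearZ.
rewrite -scalemxAl -scalerBr mxE normcM.
apply: le_trans (ler_wpM2l (normc_ge0 _) (TN x i)) _.
rewrite mulrA ler_wpM2r ?dsum_norm_ge0// mulrCA ler_piMr ?(ltW e0)//.
by rewrite ler_pdivrMr// mul1r lerDl.
Qed.

Lemma entry_bound M : exists2 b : R, 0 <= b & forall i j, normc (M i j) <= b.
Proof.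
exists (\sum_(i < n) \sum_(j < n) normc (M i j)).
  by apply: sumr_ge0 => i _; apply: sumr_ge0 => j _; exact: normc_ge0.
move=> i j; rewrite (bigD1 i)//= (bigD1 j)//= -addrA lerDl addr_ge0//.
  by apply: sumr_ge0 => k _; exact: normc_ge0.
by apply: sumr_ge0 => k _; apply: sumr_ge0 => l _; exact: normc_ge0.
Qed.

(** Boundedness of T is needed because the estimate for S is used at the
    vector T x. *)
Lemma intertwinesM S T M M' : bounded_op T ->
  intertwines S M -> intertwines T M' -> intertwines (S \o T) (M *m M').
Proof.
move=> /bounded_opP[_ [C C0 TC]] SM TM e e0.
have [b b0 Mb] := entry_bound M.
pose K := C + n%:R * b.
have K0 : 0 <= K by rewrite addr_ge0// mulr_ge0.
have K1 : 0 < K + 1 by rewrite ltr_wpDl.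
have d0 := divr_gt0 e0 K1; set d := e / (K + 1) in d0.
apply: filterS2 (SM _ d0) (TM _ d0) => N SN TN x i.
have -> : F N ((S \o T) \o x) - (M *m M') *m F N x =
    (F N (S \o (T \o x)) - M *m F N (T \o x)) +
    M *m (F N (T \o x) - M' *m F N x).
  by rewrite mulmxBr -mulmxA addrA subrK.
rewrite mxE; apply: le_trans (le_normcD _ _) _.
have Tx : dnorm (T \o x) <= C * dnorm x.
  by apply: le_dsum_norm => // c; [exact: l2norm_ge0 | exact: TC].
apply: (@le_trans _ _ (d * (C * dnorm x) + n%:R * (b * (d * dnorm x)))).
  apply: lerD; last by apply: normc_mulmx_le.
  by apply: le_trans (SN _ _) _; rewrite ler_wpM2l// ltW.
have -> : d * (C * dnorm x) + n%:R * (b * (d * dnorm x)) = d * K * dnorm x.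
  by rewrite /K; ring.
rewrite ler_wpM2r ?dsum_norm_ge0// /d mulrAC ler_pdivrMr//.
by rewrite ler_wpM2l ?(ltW e0)// lerDl.
Qed.

Lemma vnorm_delta j : vnorm (delta_mx j 0 : 'cV[R[i]]_n) = 1.
Proof.
rewrite /vnorm (bigD1 j)//= big1 ?addr0 => [|k /negbTE kj].
  by rewrite mxE !eqxx normc1 expr1n sqrtr1.
by rewrite mxE kj normc0 expr0n.
Qed.

(** Comparing S and S' through a common approximated operator T avoids any
    norm estimate for S - S'. The entry (i, j) is read off at the vector
    [V N (delta_mx j 0)], which has norm at most 1 and which F_N sends to the
    j-th basis vector; this is where a contractive right inverse of F_N is
    used. *)
Lemma intertwines_dist S S' T M M' d d' i j :
  intertwines S M -> intertwines S' M' -> 0 <= d -> 0 <= d' ->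
  opdist_le T S d -> opdist_le T S' d' -> normc (M i j - M' i j) <= d + d'.
Proof.
move=> SM SM' d0 d'0 TS TS'; apply/ler_addgt0Pr => e e0.
have e2 : 0 < e / 2 by rewrite divr_gt0.
have [N [SN SN']] := filter_ex (filterI (SM _ e2) (SM' _ e2)).
pose x := V N (delta_mx j 0).
have x1 : dnorm x <= 1 by rewrite -(vnorm_delta j) V_contr.
have MF (B : 'M[R[i]]_n) : B i j = (B *m F N x) i 0.
  by rewrite FV -colE mxE.
have -> : M i j - M' i j =
    ((F N (S' \o x) - M' *m F N x) i 0 - (F N (S \o x) - M *m F N x) i 0) +
    ((F N (T \o x) - F N (S' \o x)) i 0 - (F N (T \o x) - F N (S \o x)) i 0).
  rewrite (MF M) (MF M') !mxE; ring.
apply: le_trans (le_normcD _ _) _.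
have le1 (t : R) : 0 <= t -> t * dnorm x <= t by move=> t0; rewrite ler_piMr.
rewrite [leLHS]addrC [e]splitr; apply: lerD; apply: le_trans (normcB_le _ _) _.
  rewrite [leLHS]addrC; apply: lerD.
    by apply: le_trans (normc_F_opdist_le _ _ _ d0 TS) (le1 _ _).
  by apply: le_trans (normc_F_opdist_le _ _ _ d'0 TS') (le1 _ _).
by apply: lerD; apply: le_trans (le1 _ (ltW e2)); [exact: SN' | exact: SN].
Qed.

Lemma opdist_le_refl T : opdist_le T T 0.
Proof.
by move=> u; rewrite subrr mul0r l2norm0.
Qed.

Lemma intertwines_uniq T M M' : intertwines T M -> intertwines T M' -> M = M'.
Proof.
move=> TM TM'; apply/matrixP => i j; apply/eqP; rewrite -subr_eq0; apply/eqP.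
apply: eq0_normc; apply/eqP; rewrite eq_le normc_ge0 andbT.
rewrite -[leRHS](addr0 0).
by apply: intertwines_dist TM TM' _ _ (opdist_le_refl T) (opdist_le_refl T).
Qed.

Lemma tensor_alg_approx T (d : R) : tensor_alg R Q T -> 0 < d ->
  exists2 S, gen_alg S & opdist_le T S d.
Proof.
move=> [[linT _] Tcl] d0; have [S genS TS] := Tcl _ d0.
exists S => // u; have [linS _] := gen_alg_bounded genS.
apply: (@op_bound R Q (T - S)); [|exact: ltW|exact: ltW].
move=> a v w; rewrite -[LHS]/(T (a *: v + w) - S (a *: v + w)).
by rewrite linT linS -[(T - S) v]/(T v - S v) scalerBr opprD addrACA.
Qed.

Hypotheses (piP : vertex Q -> 'M[R[i]]_n) (piL : edge Q -> 'M[R[i]]_n).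
Hypotheses (intP : forall v, intertwines (P_ R v) (piP v))
           (intL : forall e, intertwines (L_ R e) (piL e)).

Lemma gen_alg_intertwines S : gen_alg S -> exists M, intertwines S M.
Proof.
elim=> {S} [v|e||S T _ [M SM] _ [M' TM]|c S _ [M SM]|S T _ [M SM] genT [M' TM]].
- by exists (piP v).
- by exists (piL e).
- exists 0 => e e0; apply: filterE => N x i.
  rewrite (_ : _ \o x = 0) ?linear0 ?mul0mx ?subr0//.
  by rewrite mxE normc0 mulr_ge0 ?dsum_norm_ge0 ?ltW.
- by exists (M + M'); exact: intertwinesD.
- by exists (c *: M); exact: intertwinesZ.
- by exists (M *m M'); apply: intertwinesM => //; exact: gen_alg_bounded.
Qed.

Lemma tensor_alg_intertwines T : tensor_alg R Q T -> exists M, intertwines T M.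
Proof.
move=> AT.
(* Generated operators S within d of T have matrices whose (i, j) entries are
   pairwise close; the entry of the matrix of T is a point close to all. *)
pose P i j z (d : R) := exists S M,
  [/\ gen_alg S, intertwines S M, 0 <= d, opdist_le T S d & z = M i j].
have PS d : 0 < d -> exists S M, forall i j, P i j (M i j) d /\ intertwines S M
    /\ opdist_le T S d.
  move=> d0; have [S genS TS] := tensor_alg_approx AT d0.
  have [M SM] := gen_alg_intertwines genS.
  by exists S, M => i j; split=> //; exists S, M; split=> //; exact: ltW.
have exL ij : exists L, forall z d, P ij.1 ij.2 z d -> normc (L - z) <= d + d.
  apply: nested_balls.
    by have [S [M /(_ ij.1 ij.2)[? _]]] := PS 1 ltr01; exists (M ij.1 ij.2), 1.
  move=> z d z' d' [S [M [_ SM d0 TS ->]]] [S' [M' [_ SM' d'0 TS' ->]]].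
  exact: intertwines_dist SM SM' d0 d'0 TS TS'.
have [L LP] := choice exL.
exists (\matrix_(i, j) L (i, j)) => e e0.
(* T is replaced by S, S by its matrix M, and M by the limit L: this costs
   d, d and n (2 d) times the norm of x. *)
pose K : R := 1 + (1 + n%:R * 2).
have K0 : 0 < K by rewrite !ltr_pwDl// mulr_ge0.
have d0 := divr_gt0 e0 K0; set d := e / K in d0.
have [S genS TS] := tensor_alg_approx AT d0.
have [M SM] := gen_alg_intertwines genS.
apply: filterS (SM _ d0) => N SN x i.
set L' := \matrix_(_, _) _.
have -> : F N (T \o x) - L' *m F N x = (F N (T \o x) - F N (S \o x)) +
    ((F N (S \o x) - M *m F N x) - (L' - M) *m F N x).
  by rewrite mulmxBl; rewrite opprB !addrA !subrK.
have -> : e * dnorm x =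
    d * dnorm x + (d * dnorm x + n%:R * ((d + d) * dnorm x)).
  have -> : e = d * K by rewrite /d divfK// lt0r_neq0.
  by rewrite /K; ring.
rewrite mxE; apply: le_trans (le_normcD _ _) _.
apply: lerD; first exact: normc_F_opdist_le (ltW d0) TS.
rewrite mxE [X in _ + X]mxE; apply: le_trans (normcB_le _ _) _.
apply: lerD; first exact: SN.
apply: normc_mulmx_le => j; last exact: normc_F_le.
rewrite !mxE; apply: (LP (i, j)); exists S, M; split=> //; exact: ltW.
Qed.

(** Complete contractivity: B y is a limit of F_N (A (V_N y)), with
    F_N and V_N applied in each of the k coordinates, and the norm of A on
    the n-fold sum of H^k is the one on H^k. *)
Lemma mxmx_norm_intertwined_le k (A : 'M[H -> H]_k) (B : 'M['M[R[i]]_n]_k) :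
  (forall a b, tensor_alg R Q (A a b)) ->
  (forall a b, intertwines (A a b) (B a b)) ->
  (mxmx_norm B <= mx_opnorm norm norm A)%E.
Proof.
move=> AA AB.
have linA a b t u : A a b (t *: u) = t *: A a b u.
  by have [[lin _] _] := AA a b; exact: linear_scale.
have A0 : mxact A 0 = 0.
  apply/funext => a; apply: big1 => b _.
  by have := linA a b 0 0; rewrite !scale0r.
have n0 : @dsum_norm R H norm k 0 = 0.
  by rewrite /dsum_norm big1 ?sqrtr0// => b _; rewrite l2norm0 expr0n.
have ge0 : (0%:E <= mx_opnorm norm norm A)%E.
  apply: ereal_sup_ubound; exists 0; first by rewrite /= n0.
  by rewrite A0 n0.
case E: (mx_opnorm _ _ A) ge0 => [d| |] /=; rewrite ?leey// ?leeNy_eq//.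
rewrite [X in is_true X -> _]lee_fin => d0.
have Ad z : dsum_norm norm (mxact A z) <= d * dsum_norm norm z.
  apply: (@opnorm_bound R ('I_k -> H) ('I_k -> H)) => //.
  - by move=> ?; exact: dsum_norm_ge0.
  - move=> t y t0; apply: le_dsum_norm => [|i|i]; first exact: ltW.
      exact: l2norm_ge0.
    exact: l2norm_realZ.
  - move=> t y t0; apply: le_dsum_norm => [|i|i]; first exact: ltW.
      exact: l2norm_ge0.
    exact: l2norm_realZ.
  - move=> t y; apply/funext => a.
    rewrite -[RHS]/(t%:C *: \sum_(b < k) A a b (y b)) scaler_sumr.
    by apply: eq_bigr => b _; rewrite -linA.
  - by move: E; rewrite /mx_opnorm => ->.
apply: ge_ereal_sup => _ [y /= y1 <-]; rewrite lee_fin.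
set By := mxact _ _.
(* If |s| <= d and |t| <= e <= 1, then |s + t|^2 <= |s|^2 + (2 d + 1) e; there
   are k n coordinates. *)
pose C : R := (k * n)%:R * (2 * d + 1).
have C0 : 0 <= C by rewrite mulr_ge0// addr_ge0// mulr_ge0.
suff key e : 0 < e -> e <= 1 -> dsum_norm (@vnorm R n) By ^+ 2 <= d ^+ 2 + C * e.
  rewrite -ler_sqr ?nnegrE ?dsum_norm_ge0//; apply/ler_addgt0Pr => e e0.
  have C1 : 0 < C + 1 by rewrite ltr_wpDl.
  have e'0 : 0 < Num.min 1 (e / (C + 1)) by rewrite lt_min ltr01 divr_gt0.
  apply: le_trans (key _ e'0 _) _; first by rewrite ge_min lexx.
  rewrite lerD2l; apply: (@le_trans _ _ (C * (e / (C + 1)))).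
    by rewrite ler_wpM2l// ge_min lexx orbT.
  by rewrite mulrCA ler_piMr ?(ltW e0)// ler_pdivrMr// mul1r lerDl.
move=> e0 e1.
have k1 : 0 < k%:R + 1 :> R by rewrite ltr_wpDl.
have /filter_ex[N AN] : \forall N \near \oo, forall a b x i,
    normc ((F N (A a b \o x) - B a b *m F N x) i 0) <= e / (k%:R + 1) * dnorm x.
  apply: filter_forall => a; apply: filter_forall => b.
  by apply: AB; exact: divr_gt0.
pose x b := V N (y b).
have x1 : \sum_(b < k) dnorm (x b) ^+ 2 <= 1.
  apply: (@le_trans _ _ (dsum_norm (@vnorm R n) y ^+ 2)); last first.
    by rewrite expr_le1 ?dsum_norm_ge0.
  rewrite dsum_norm_sqr; apply: ler_sum => b _.
  by rewrite ler_sqr ?nnegrE ?dsum_norm_ge0 ?vnorm_ge0//; exact: V_contr.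
pose Ax a : 'I_n -> H := fun c => mxact A (fun b => x b c) a.
have Axd : \sum_(a < k) dnorm (Ax a) ^+ 2 <= d ^+ 2.
  rewrite (eq_bigr _ (fun a _ => dsum_norm_sqr norm (Ax a))) exchange_big /=.
  apply: (@le_trans _ _ (\sum_(c < n) d ^+ 2 * \sum_(b < k) norm (x b c) ^+ 2)).
    apply: ler_sum => c _; rewrite -!dsum_norm_sqr -exprMn.
    by rewrite ler_sqr ?nnegrE ?mulr_ge0 ?dsum_norm_ge0//; exact: Ad.
  rewrite -mulr_sumr exchange_big /= ler_piMr ?sqr_ge0//.
  by rewrite -(eq_bigr _ (fun b _ => dsum_norm_sqr norm (x b))).
have err a i : normc (By a i 0 - F N (Ax a) i 0) <= e.
  have -> : By a i 0 - F N (Ax a) i 0 =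
      - \sum_(b < k) (F N (A a b \o x b) - B a b *m F N (x b)) i 0.
    have -> : Ax a = \sum_(b < k) (A a b \o x b).
      by apply/funext => c; rewrite /Ax /mxact fct_sumE.
    rewrite linear_sum -sumrN /By /mxact !summxE -sumrB.
    by apply: eq_bigr => b _; rewrite FV !mxE opprB.
  rewrite normcN; apply: (@le_trans _ _ (\sum_(b < k) e / (k%:R + 1))).
    apply: (big_ind2 (fun s t => normc s <= t)) => [|s s' t t' ss tt|b _].
    - by rewrite normc0.
    - by apply: le_trans (le_normcD _ _) _; rewrite lerD.
    apply: le_trans (AN _ _ _ _) _; rewrite ler_piMr ?divr_ge0 ?(ltW e0) ?(ltW k1)//.
    rewrite -(@expr_le1 _ 2) ?dsum_norm_ge0//; apply: le_trans x1.
    by rewrite (bigD1 b)//= lerDl sumr_ge0// => ? _; rewrite sqr_ge0.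
  rewrite sumr_const card_ord -[leLHS]mulr_natr mulrAC ler_pdivrMr//.
  by rewrite ler_wpM2l ?(ltW e0)// lerDl.
have Fd a i : normc (F N (Ax a) i 0) <= d.
  apply: le_trans (normc_F_le _ _ _) _.
  rewrite -ler_sqr ?nnegrE ?dsum_norm_ge0//; apply: le_trans Axd.
  by rewrite (bigD1 a)//= lerDl sumr_ge0// => ? _; rewrite sqr_ge0.
rewrite dsum_norm_sqr.
apply: (@le_trans _ _ (\sum_(a < k) (vnorm (F N (Ax a)) ^+ 2 +
                                     n%:R * ((2 * d + 1) * e)))).
  apply: ler_sum => a _; rewrite !vnorm_sqr.
  have -> : n%:R * ((2 * d + 1) * e) = \sum_(i < n) (2 * d + 1) * e.
    by rewrite sumr_const card_ord mulr_natl.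
  rewrite -big_split; apply: ler_sum => i _ /=.
  have := le_normcD (F N (Ax a) i 0) (By a i 0 - F N (Ax a) i 0).
  rewrite [F N _ i 0 + _]addrC subrK; have := err a i; have := Fd a i.
  have := normc_ge0 (By a i 0); have := normc_ge0 (F N (Ax a) i 0).
  have := normc_ge0 (By a i 0 - F N (Ax a) i 0).
  move: (normc (By a i 0)) (normc (F N (Ax a) i 0)) (normc (_ - _)) => r s t.
  move=> t0 s0 r0 sd te rst.
  have r2 : r ^+ 2 <= (s + e) ^+ 2 by rewrite ler_sqr ?nnegrE; lra.
  have se : s * e <= d * e by rewrite ler_wpM2r// ltW.
  have ee : e * e <= e by rewrite ler_piMr// ltW.
  nra.
rewrite big_split /= sumr_const card_ord -[X in _ + X]mulr_natl.
rewrite lerD//; last by rewrite /C natrM !mulrA.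
apply: le_trans Axd; apply: ler_sum => a _.
by rewrite ler_sqr ?nnegrE ?vnorm_ge0 ?dsum_norm_ge0.
Qed.

(** The existence of the representation is thus reduced to asymptotic
    intertwining relations for the generators only. *)
Theorem asymptotic_compression :
  exists phi : (H -> H) -> 'M[R[i]]_n,
    [/\ cc_representation (tensor_alg R Q) phi,
        forall v, phi (P_ R v) = piP v & forall e, phi (L_ R e) = piL e].
Proof.
pose phi T := xget 0 [set M | intertwines T M].
have phiE T M : intertwines T M -> phi T = M.
  move=> TM; rewrite /phi; case: xgetP => [M' _ TM'|/(_ M)//].
  exact: intertwines_uniq TM' TM.
have phiP T : tensor_alg R Q T -> intertwines T (phi T).
  by move=> /tensor_alg_intertwines[M TM]; rewrite (phiE _ _ TM).
exists phi; split=> [|v|e]; [|exact: phiE|exact: phiE].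
split=> [S T AS AT|c S AS|S T AS AT|k A AA].
- by apply: phiE; apply: intertwinesD; exact: phiP.
- by apply: phiE; apply: intertwinesZ; exact: phiP.
- by apply: phiE; apply: intertwinesM; [case: AT|exact: phiP|exact: phiP].
- by apply: mxmx_norm_intertwined_le => // a b; rewrite mxE; exact: phiP.
Qed.

End AsymptoticCompression.

(** * Walks along a cycle *)

Section CyclicWalks.
Variables (Q : digraph) (w : fpath Q).
Local Notation n := (plen w).
Local Notation next := (@ordS n).
Implicit Types (i j : 'I_n) (m : nat).

Definition vertex_path (v : vertex Q) : fpath Q :=
  exist _ (v, [::]) (eqxx v).

Definition base i : vertex Q := src (nth_edge i).

(** For n > 0 this says that w is a cycle, in a form that treats the passage
    from the last edge to the first one like all the others. *)
Definition closed_up := forall i, rng (nth_edge (next i)) = base i.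

(** The path e_(i+1) ... e_(i+m), indices modulo n, with range s(e_i). The
    default value is only reached if m > 0 and w is not a cycle, a case in which
    the walks are not used. *)
Fixpoint walk i m : fpath Q :=
  if m is m'.+1 then
    if path_rng (walk (next i) m') =P src (nth_edge (next i)) is ReflectT h
    then cons_path h else vertex_path (base i)
  else vertex_path (base i).

Lemma path_rng_walk i m : m = 0%N \/ closed_up -> path_rng (walk i m) = base i.
Proof.
elim: m i => [//|m IH] i [//|cl] /=; case: eqP => [h|//].
by rewrite /path_rng /= cl.
Qed.

Lemma walkS i m : closed_up ->
  exists h : path_rng (walk (next i) m) = src (nth_edge (next i)),
    walk i m.+1 = cons_path h.
Proof.
move=> cl /=; case: eqP => [h|]; first by exists h.
by case; rewrite path_rng_walk//; right.
Qed.

Lemma plen_walk i m : m = 0%N \/ closed_up -> plen (walk i m) = m.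
Proof.
elim: m i => [//|m IH] i [//|cl].
have [h ->] := walkS i m cl; rewrite -[LHS]/(plen (walk (next i) m)).+1.
by rewrite IH//; right.
Qed.

Lemma uncons_walkS e i m : closed_up -> uncons_path e (walk i m.+1) =
  if nth_edge (next i) == e then Some (walk (next i) m) else None.
Proof.
move=> cl; have [h ->] := walkS i m cl; case: eqP => [<-|ne].
  by apply/uncons_pathP; exists h.
by rewrite /uncons_path /edges /=; case: eqP.
Qed.

Lemma iter_nextK m : cancel (iter m next) (iter m (@ord_pred n)).
Proof. by elim: m => // m IH i; rewrite iterSr /= ordSK IH. Qed.

Lemma iter_predK m : cancel (iter m (@ord_pred n)) (iter m next).
Proof. by elim: m => // m IH i; rewrite iterSr /= ord_predK IH. Qed.

Lemma is_cycle_closed_up : is_cycle w -> closed_up.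
Proof.
rewrite /is_cycle /closed_up /base /nth_edge /ordS /= => cyc i.
have /andP[] := valP w; rewrite -/(edges w) -/(path_src w).
move: cyc i; rewrite /path_rng /plen.
case: (edges w) => [_ [] //|e s] /= cyc i srt /eqP ls.
rewrite !(tnth_nth e) /=; have [i_s|s_i] := ltnP i (size s).
  rewrite modn_small ?ltnS// -[nth _ _ _]/(nth e s i).
  by move/(pathP e): srt => /(_ _ i_s)/eqP ->.
have iE : nat_of_ord i = size s.
  by apply/eqP; rewrite eqn_leq s_i andbT -ltnS ltn_ord.
rewrite iE modnn /= cyc -ls (last_map (@src Q)).
by rewrite -[last e s]/(last e (e :: s)) -nth_last.
Qed.

End CyclicWalks.

(** * The compressions attached to a path *)

(** The Cauchy-Schwarz inequality for a unit vector a, from the nonnegativity of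
    the squared norm of b - <a, b> a. *)
Lemma sum_unit_weights_sqr_le (R : realType) N (a b : 'I_N -> R) :
  \sum_(m < N) a m ^+ 2 = 1 ->
  (\sum_(m < N) a m * b m) ^+ 2 <= \sum_(m < N) b m ^+ 2.
Proof.
move=> a1; set t := \sum_(m < N) a m * b m.
have : 0 <= \sum_(m < N) (b m - t * a m) ^+ 2.
  by apply: sumr_ge0 => m _; exact: sqr_ge0.
rewrite (eq_bigr (fun m => b m ^+ 2 + (t ^+ 2 * a m ^+ 2 - (2 * t) * (a m * b m)))).
  by rewrite big_split sumrB -!mulr_sumr a1 -/t /=; nra.
by move=> m _; ring.
Qed.

Section WalkCompression.
Variables (R : realType) (Q : digraph) (w : fpath Q) (lambda mu : R[i]).
Local Notation n := (plen w).
Local Notation next := (@ordS n).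
Local Notation pred := (@ord_pred n).
Local Notation H := (fock R Q).
Local Notation norm := (@l2norm R (fpath Q)).
Local Notation dnorm := (@dsum_norm R H norm n).
Local Notation r := (normc lambda).
Implicit Types (i j : 'I_n) (m : nat) (x : 'I_n -> H).
Hypotheses (lambda_le1 : r <= 1) (mu1 : normc mu = 1)
           (cl : lambda != 0 -> closed_up w).

(** The coefficient of the unit in column j, that is lambda for e_(j-1,j) and
    lambda mu when e_(0,1) stands for mu e_(n,1). *)
Definition step j : R[i] := lambda * (if val j == 0%N then mu else 1).

Lemma normc_step j : normc (step j) = r.
Proof. by rewrite normcM; case: ifP; rewrite ?mu1 ?normc1 mulr1. Qed.

Fixpoint phase i m : R[i] :=
  if m is m'.+1 then step (next i) * phase (next i) m' else 1.

Lemma normc_phase i m : normc (phase i m) = r ^+ m.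
Proof.
elim: m i => [|m IH] i /=; first exact: normc1.
by rewrite normcM normc_step IH exprS.
Qed.

(** The number of walks from each position in the k-th compression. With a single
    trivial walk when lambda = 0, the walks of positive length, which need w to
    be a cycle, do not occur. *)
Definition horizon k : nat := if lambda == 0 then 1 else k.+1.

Lemma horizon_walk k m : (m < horizon k)%N -> m = 0%N \/ closed_up w.
Proof.
rewrite /horizon; case: eqP => [_|/eqP/cl]; last by right.
by case: m => // _; left.
Qed.

Definition mass k : R := \sum_(m < horizon k) r ^+ m ^+ 2.
Definition weight k : R := (Num.sqrt (mass k))^-1.

Lemma mass_gt0 k : 0 < mass k.
Proof.
rewrite /mass; have : (0 < horizon k)%N by rewrite /horizon; case: ifP.
case: (horizon k) => // N _; rewrite big_ord_recl expr0 expr1n.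
by rewrite ltr_pwDl// sumr_ge0// => m _; exact: sqr_ge0.
Qed.

Lemma weight_ge0 k : 0 <= weight k.
Proof. by rewrite invr_ge0 sqrtr_ge0. Qed.

Lemma weight_sqr k : weight k ^+ 2 = (mass k)^-1.
Proof. by rewrite exprVn sqr_sqrtr// ltW// mass_gt0. Qed.

Lemma sum_weights k : \sum_(m < horizon k) (weight k * r ^+ m) ^+ 2 = 1.
Proof.
under eq_bigr do rewrite exprMn.
by rewrite -mulr_sumr weight_sqr -/(mass k) mulVf// lt0r_neq0// mass_gt0.
Qed.

Definition coef k i m : R[i] := (weight k)%:C * phase i m.

Lemma normc_coef k i m : normc (coef k i m) = weight k * r ^+ m.
Proof. by rewrite normcM normc_phase normc_real// weight_ge0. Qed.

Definition coord (x : H) (p : fpath Q) : R[i] := val x p.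

(** The map F_N of the introduction, for N = [horizon k]. It is written with
    finitely many coordinates of x, so that no inner product of H is needed. *)
Definition compress k x : 'cV[R[i]]_n :=
  \col_i \sum_(m < horizon k) coef k i m * coord (x (iter m next i)) (walk i m).

Lemma compress_linear k : linear (compress k).
Proof.
move=> a x y; apply/colP => i; rewrite !mxE mulr_sumr -big_split.
apply: eq_bigr => m _ /=.
rewrite -[coord ((a *: x + y) _) _]/(a * coord (x _) _ + coord (y _) _); ring.
Qed.

HB.instance Definition _ k :=
  GRing.isLinear.Build R[i] ('I_n -> H) 'cV[R[i]]_n _ (compress k)
    (compress_linear k).

(** The adjoint V_N of [compress k]: position i contributes to the component c
    = i + m of H (x) C^n. *)
Definition dilate k (y : 'cV[R[i]]_n) : 'I_n -> H := fun c =>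
  \sum_(m < horizon k) ((coef k (iter m pred c) m)^*%C * y (iter m pred c) 0) *:
     xi R (walk (iter m pred c) m).

Lemma walk_inj k i i' m m' : (m < horizon k)%N -> (m' < horizon k)%N ->
  walk i m = walk i' m' -> m = m'.
Proof.
move=> /horizon_walk mk /horizon_walk mk' /(congr1 (@plen Q)).
by rewrite !plen_walk.
Qed.

(** Cauchy-Schwarz with weights of total mass 1, then Bessel in each
    component c: the walks that end at the position c have different lengths. *)
Lemma compress_contractive k x : vnorm (compress k x) <= dnorm x.
Proof.
rewrite -ler_sqr ?nnegrE ?vnorm_ge0 ?dsum_norm_ge0// vnorm_sqr dsum_norm_sqr.
apply: (@le_trans _ _ (\sum_(i < n) \sum_(m < horizon k)
    normc (coord (x (iter m next i)) (walk i m)) ^+ 2)).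
  apply: ler_sum => i _; rewrite mxE.
  apply: le_trans (sum_unit_weights_sqr_le _ (sum_weights k)).
  rewrite ler_sqr ?nnegrE ?normc_ge0//; last first.
    by apply: sumr_ge0 => m _; rewrite -(normc_coef k i m) mulr_ge0 ?normc_ge0.
  apply: (big_ind2 (fun s t => normc s <= t)) => [|s s' t t' ss tt|m _].
  - by rewrite normc0.
  - by apply: le_trans (le_normcD _ _) _; rewrite lerD.
  - by rewrite normcM normc_coef.
rewrite exchange_big /=.
rewrite (eq_bigr (fun m : 'I_(horizon k) => \sum_(c < n)
    normc (coord (x c) (walk (iter m pred c) m)) ^+ 2)); last first.
  move=> m _; rewrite (reindex (iter m pred)) /=.
    by apply: eq_bigr => c _; rewrite iter_predK.
  by exists (iter m next) => c _; rewrite ?iter_nextK ?iter_predK.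
rewrite exchange_big /=; apply: ler_sum => c _.
apply: (@Bessel_ord _ _ _ (fun m : 'I_(horizon k) => walk (iter m pred c) m)).
by move=> m m' mm'; apply: val_inj; apply: walk_inj mm'.
Qed.

Lemma dilate_contractive k y : dnorm (dilate k y) <= vnorm y.
Proof.
rewrite -ler_sqr ?nnegrE ?vnorm_ge0 ?dsum_norm_ge0// vnorm_sqr dsum_norm_sqr.
apply: (@le_trans _ _ (\sum_(c < n) \sum_(m < horizon k)
    (weight k * r ^+ m) ^+ 2 * normc (y (iter m pred c) 0) ^+ 2)).
  apply: ler_sum => c _.
  have qinj : injective (fun m : 'I_(horizon k) => walk (iter m pred c) m).
    by move=> m m' mm'; apply: val_inj; apply: walk_inj mm'.
  apply: le_trans (l2norm_sum_basis_le _ qinj) _.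
  apply: ler_sum => m _.
  by rewrite normcM exprMn normc_conj normc_coef.
rewrite exchange_big /=.
rewrite (eq_bigr (fun m : 'I_(horizon k) => (weight k * r ^+ m) ^+ 2 *
    \sum_(i < n) normc (y i 0) ^+ 2)).
  by rewrite -mulr_suml sum_weights mul1r.
move=> m _; rewrite -mulr_sumr; congr (_ * _).
rewrite [RHS](reindex (iter m pred)) //=.
by exists (iter m next) => c _; rewrite ?iter_nextK ?iter_predK.
Qed.

Lemma coord_dilate k y i m : (m < horizon k)%N ->
  coord (dilate k y (iter m next i)) (walk i m) = (coef k i m)^*%C * y i 0.
Proof.
move=> mk; pose c := iter m next i.
have -> : coord (dilate k y c) (walk i m) = \sum_(m' < horizon k)
    (coef k (iter m' pred c) m')^*%C * y (iter m' pred c) 0 *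
    (walk i m == walk (iter m' pred c) m')%:R.
  rewrite /coord /dilate raddf_sum /=.
  by elim/big_rec2: _ => // m' y1 y2 _ <-.
rewrite (bigD1 (Ordinal mk))//= big1 ?addr0 => [|m' ne].
  by rewrite iter_nextK eqxx mulr1.
case: eqP => [/(walk_inj mk (ltn_ord m')) mm'|_]; last by rewrite mulr0.
by move: ne; rewrite -val_eqE /= mm' eqxx.
Qed.

Lemma compress_dilate k y : compress k (dilate k y) = y.
Proof.
apply/colP => i; rewrite mxE.
rewrite (eq_bigr (fun m : 'I_(horizon k) =>
    ((weight k * r ^+ m) ^+ 2)%:C * y i 0)) => [|m _].
  by rewrite -mulr_suml -rmorph_sum /= sum_weights mul1r.
rewrite coord_dilate// mulrA; congr (_ * _).
by rewrite -(normc_coef k i m) rmorphXn /= -sqr_normc.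
Qed.

Lemma pi_PE v i j : pi_P R w v i j = ((i == j) && (base i == v))%:R.
Proof.
rewrite /pi_P summxE; have [iv|iv] := boolP (base i == v).
  rewrite (bigD1 i)//= big1 => [|k /andP[_ ki]].
    by rewrite addr0 mxE eqxx andbT eq_sym.
  by rewrite mxE [i == k]eq_sym (negbTE ki).
rewrite andbF big1// => k kv; rewrite mxE.
by case: eqP => // ik; move: iv; rewrite /base ik kv.
Qed.

Lemma pi_LE e i j : pi_L w lambda mu e i j =
  if (j == next i) && (nth_edge j == e) then step j else 0.
Proof.
rewrite /pi_L summxE.
have term k : (lambda *: shift_unit mu k) i j =
    if (j == k) && (j == next i) then step j else 0.
  have [->|jk] := eqVneq j k; last first.
    rewrite mxE /shift_unit; case: ifP => _; rewrite !mxE (negbTE jk) andbF.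
      by rewrite !mulr0.
    by rewrite mulr0.
  have -> : (k == next i) = (i == pred k).
    by apply/eqP/eqP => [->|->]; rewrite ?ordSK ?ord_predK.
  rewrite mxE /shift_unit /step; case: ifP => k0; rewrite !mxE eqxx andbT.
    by case: eqP; rewrite ?mulr1 ?mulr0.
  by case: eqP; rewrite ?mulr1 ?mulr0.
rewrite (eq_bigr _ (fun k _ => term k)).
have [je|je] := boolP (nth_edge j == e).
  rewrite (bigD1 j)//= eqxx big1 ?addr0 ?andbT// => k /andP[_ /negbTE kj].
  by rewrite eq_sym kj.
rewrite andbF big1// => k ke; case: eqP => // jk.
by move: je; rewrite jk ke.
Qed.

Lemma pi_P_mulmx v p (y : 'M[R[i]]_(n, p)) i c :
  (pi_P R w v *m y) i c = if base i == v then y i c else 0.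
Proof.
rewrite mxE (bigD1 i)//= big1 ?addr0 => [|j /negbTE ji].
  by rewrite pi_PE eqxx /=; case: eqP; rewrite ?mul1r ?mul0r.
by rewrite pi_PE eq_sym ji mul0r.
Qed.

Lemma pi_L_mulmx e p (y : 'M[R[i]]_(n, p)) i c : (pi_L w lambda mu e *m y) i c =
  if nth_edge (next i) == e then step (next i) * y (next i) c else 0.
Proof.
rewrite mxE (bigD1 (next i))//= big1 ?addr0 => [|j /negbTE ji].
  by rewrite pi_LE eqxx /=; case: eqP; rewrite ?mul0r.
by rewrite pi_LE ji mul0r.
Qed.

Lemma compress_P v k x : compress k (P_ R v \o x) = pi_P R w v *m compress k x.
Proof.
apply/colP => i; rewrite pi_P_mulmx !mxE.
rewrite (eq_bigr (fun m : 'I_(horizon k) => if base i == v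
    then coef k i m * coord (x (iter m next i)) (walk i m) else 0)) => [|m _].
  by case: eqP => // _; rewrite big1.
rewrite -[coord _ _]/(if with_range v (walk i m) is Some q
  then coord (x (iter m next i)) q else 0).
rewrite /with_range path_rng_walk; last exact: horizon_walk (ltn_ord m).
by case: eqP => //; rewrite mulr0.
Qed.

(** The annihilated trivial walk from i and the walk of maximal length
    from i + 1, which has no counterpart, are the two ends of the sums to be
    compared; all other terms agree in pairs. *)
Lemma compress_L_defect e k x i :
  normc ((compress k (L_ R e \o x) - pi_L w lambda mu e *m compress k x) i 0)
    <= r * (weight k * r ^+ (horizon k).-1) * dnorm x.
Proof.
rewrite mxE [X in _ + X]mxE pi_L_mulmx !mxE.
have hE : horizon k = (horizon k).-1.+1 by rewrite /horizon; case: ifP.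
set N := (horizon k).-1 in hE *; rewrite hE big_ord_recl big_ord_recr /=.
pose f m := coef k (next i) m * coord (x (iter m next (next i))) (walk (next i) m).
rewrite -[coord (L_ R e _) _]/(0 : R[i]) mulr0 add0r.
rewrite (eq_bigr (fun m : 'I_N => if nth_edge (next i) == e
    then step (next i) * f m else 0)) => [|m _].
  case: eqP => [_|_]; last first.
    rewrite big1// subr0 normc0 !mulr_ge0 ?normc_ge0 ?weight_ge0 ?exprn_ge0//.
      exact: normc_ge0.
    exact: dsum_norm_ge0.
  rewrite -mulr_sumr mulrDr opprD addrA subrr add0r normcN normcM normc_step.
  rewrite -mulrA ler_wpM2l ?normc_ge0// normcM normc_coef ler_wpM2l//.
    by rewrite mulr_ge0 ?weight_ge0 ?exprn_ge0 ?normc_ge0.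
  apply: le_trans (normc_le_l2norm _ _) _.
  by apply: le_dsum_norm_coord => ?; exact: l2norm_ge0.
have clw : closed_up w.
  by have /horizon_walk[] : (m.+1 < horizon k)%N by rewrite hE ltnS.
rewrite -[coord (L_ R e _) _]/(if uncons_path e (walk i m.+1) is Some q
  then coord (x (iter m.+1 next i)) q else 0).
rewrite uncons_walkS//; case: eqP => _; last by rewrite mulr0.
by rewrite iterSr /f /coef /= ; ring.
Qed.

(** As |lambda| <= 1, the last of the k + 1 terms |lambda|^(2m) of the mass is the
    smallest one, hence at most their average. *)
Lemma defect_sqr_le k :
  (r * (weight k * r ^+ (horizon k).-1)) ^+ 2 <= k.+1%:R^-1.
Proof.
have r0 := normc_ge0 lambda; rewrite !exprMn weight_sqr.
have [l0|l0] := eqVneq lambda 0.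
  have -> : r = 0 by rewrite l0; exact: normc0.
  by rewrite expr0n mul0r invr_ge0.
have hE : horizon k = k.+1 by rewrite /horizon (negbTE l0).
rewrite hE /=; apply: (@le_trans _ _ ((mass k)^-1 * r ^+ k ^+ 2)).
  by rewrite ler_piMl ?expr_le1// mulr_ge0 ?invr_ge0 ?(ltW (mass_gt0 _)) ?sqr_ge0.
rewrite mulrC ler_pdivrMr ?mass_gt0// ler_pdivlMl// /mass hE.
rewrite -[X in X%:R * _]card_ord -sumr_const mulr_suml.
apply: ler_sum => m _; rewrite mul1r ler_sqr ?nnegrE ?exprn_ge0//.
by rewrite ler_wiXn2l// -ltnS.
Qed.

Lemma compress_intertwines_P v :
  intertwines compress (P_ R v) (pi_P R w v).
Proof.
move=> e e0; apply: filterE => k x i.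
rewrite /= compress_P subrr mxE; rewrite (_ : normc _ = 0); last exact: normc0.
by rewrite mulr_ge0 ?(ltW e0) ?dsum_norm_ge0.
Qed.

Lemma compress_intertwines_L e :
  intertwines compress (L_ R e) (pi_L w lambda mu e).
Proof.
move=> eps eps0; exists (Num.bound (eps ^- 2)) => // k /= Kk x i.
apply: le_trans (compress_L_defect _ _ _ _) _.
rewrite ler_wpM2r ?dsum_norm_ge0//.
rewrite -ler_sqr ?nnegrE ?(ltW eps0)//; last first.
  by rewrite !mulr_ge0 ?normc_ge0 ?weight_ge0 ?exprn_ge0 ?normc_ge0.
apply: le_trans (defect_sqr_le _) _.
rewrite -[leRHS]invrK lef_pV2 ?posrE ?invr_gt0 ?exprn_gt0//.
apply: le_trans (ltW (archi_boundP _)) _; first by rewrite invr_ge0 sqr_ge0.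
by rewrite ler_nat (leq_trans Kk).
Qed.

Theorem walk_representation :
  exists phi : (H -> H) -> 'M[R[i]]_n,
    [/\ cc_representation (tensor_alg R Q) phi,
        forall v, phi (P_ R v) = pi_P R w v &
        forall e, phi (L_ R e) = pi_L w lambda mu e].
Proof.
apply: (@asymptotic_compression _ _ _ compress dilate).
- exact: compress_contractive.
- exact: compress_dilate.
- exact: dilate_contractive.
- exact: compress_intertwines_P.
- exact: compress_intertwines_L.
Qed.

End WalkCompression.

(** * Primitive cycles *)

Lemma flatten_nseq_mkseq (T : Type) (h : nat -> T) g k :
  (forall t, h (g + t)%N = h t) ->
  flatten (nseq k (mkseq h g)) = mkseq h (k * g).
Proof.
move=> hg; elim: k => [//|k IH] /=.
rewrite IH mulSn /mkseq iotaD map_cat; congr (_ ++ _).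
have -> : iota (0 + g) (k * g) = [seq (g + t)%N | t <- iota 0 (k * g)].
  by rewrite -iotaDl addn0.
rewrite -map_comp.
by apply: eq_map => t /=; rewrite hg.
Qed.

Section PrimitiveCycles.
Variables (Q : digraph) (w : fpath Q).
Local Notation n := (plen w).
Local Notation next := (@ordS n).
Implicit Types (i j : 'I_n) (m : nat).

Lemma val_iter_next i m : val (iter m next i) = ((i + m) %% n)%N.
Proof.
elim: m => [|m IH]; first by rewrite addn0 modn_small.
by rewrite iterS /= IH -addn1 modnDml addn1 addnS.
Qed.

Lemma iter_next_mod i m : iter (m %% n) next i = iter m next i.
Proof. by apply: val_inj; rewrite !val_iter_next modnDmr. Qed.

(** If w reads the same from i and from j, its edges are periodic of period
    d = j - i and of period n, hence of period g = gcd(d, n) by Bezout. As g is a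
    proper divisor of n, w is the power n / g of its prefix of length g. *)
Lemma primitive_aperiodic i j : primitive w ->
  (forall m, nth_edge (iter m next i) = nth_edge (iter m next j)) -> i = j.
Proof.
move=> prim.
wlog lt_ij : i j / (i < j)%N.
  move=> wl eij; have [ij|ji|] := ltngtP i j; last exact: val_inj.
    exact: wl.
  by apply/esym/wl.
move=> eij; exfalso.
have n0 : (0 < n)%N by apply: leq_ltn_trans (ltn_ord i).
pose h t := nth (nth_edge i) (edges w) (t %% n).
have hn t k : h (k * n + t)%N = h t by rewrite /h modnMDl.
have eh l m : nth_edge (iter m next l) = h (l + m)%N.
  by rewrite /nth_edge (tnth_nth (nth_edge i)) /= val_iter_next.
pose d := (j - i)%N; have d0 : (0 < d)%N by rewrite subn_gt0.
have hd t : h (d + t)%N = h t.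
  rewrite -(hn t i) -(hn _ i).
  (* Adding i full turns makes the index large enough to start reading at i. *)
  have le_i : (i <= i * n + t)%N.
    by rewrite -{1}[val i]muln1 (leq_trans _ (leq_addr _ _))// leq_mul.
  have -> : (i * n + (d + t) = j + (i * n + t - i))%N.
    by rewrite addnCA /d -{1}(subnKC le_i) addnA subnK// ltnW.
  by rewrite -eh -eij eh subnKC.
have hdk t k : h (k * d + t)%N = h t.
  by elim: k => [//|k IH]; rewrite mulSn -addnA hd.
pose g := gcdn d n.
have hg t : h (g + t)%N = h t.
  rewrite /g; case: (egcdnP n d0) => u v uv _.
  by rewrite -(hn _ v) addnA -uv hdk.
have g0 : (0 < g)%N by rewrite gcdn_gt0 d0.
have gn : (g %| n)%N by exact: dvdn_gcdr.
have g_lt : (g < n)%N.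
  apply: leq_ltn_trans (dvdn_leq d0 (dvdn_gcdl _ _)) _.
  by apply: leq_ltn_trans (leq_subr _ _) (ltn_ord j).
have sE : edges w = mkseq h n.
  apply: (@eq_from_nth _ (nth_edge i)) => [|t tn]; first by rewrite size_mkseq.
  by rewrite nth_mkseq// /h modn_small.
pose s := mkseq h g.
pose v := last (path_src w) [seq src e | e <- s].
have s_path : is_path (v, s).
  have /andP[srt _] := valP w; rewrite /is_path /= /v; apply/andP; split.
    have -> : s = take g (edges w).
      by rewrite sE /s /mkseq -map_take take_iota (minn_idPl (ltnW g_lt)).
    exact: take_sorted.
  by rewrite /s /mkseq; case: (g) g0.
apply: (prim (exist _ (v, s) s_path) (n %/ g)%N).
  by rewrite ltn_divRL// mul1n.
by rewrite sE /edges /= flatten_nseq_mkseq// divnK.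
Qed.

End PrimitiveCycles.

(** * Generation of the matrix algebra *)

Section Surjectivity.
Variables (R : realType) (Q : digraph) (w : fpath Q) (lambda mu : R[i]).
Local Notation n := (plen w).
Local Notation next := (@ordS n).
Implicit Types (i j : 'I_n) (m : nat).
Hypotheses (lambda0 : lambda != 0) (mu0 : mu != 0) (prim : primitive w).

Lemma step_neq0 j : step lambda mu j != 0.
Proof. by rewrite mulf_neq0//; case: ifP => // _; exact: oner_neq0. Qed.

Lemma phase_neq0 i m : phase lambda mu i m != 0.
Proof.
elim: m i => [|m IH] i /=; first exact: oner_neq0.
by rewrite mulf_neq0 ?step_neq0.
Qed.

(** The image of L_(e_(i+1)) ... L_(e_(i+m)) under the representation. *)
Fixpoint walk_mx i m : 'M[R[i]]_n :=
  if m is m'.+1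
  then pi_L w lambda mu (nth_edge (next i)) *m walk_mx (next i) m' else 1%:M.

Fixpoint agree m i j : bool :=
  if m is m'.+1
  then (nth_edge (next j) == nth_edge (next i)) && agree m' (next i) (next j)
  else true.

Lemma walk_mxE m i j l : walk_mx i m j l =
  if agree m i j && (l == iter m next j) then phase lambda mu j m else 0.
Proof.
elim: m i j => [|m IH] i j; first by rewrite /= mxE eq_sym; case: eqP.
rewrite iterSr /= pi_L_mulmx IH.
by case: eqP => //= _; case: ifP; rewrite ?mulr0.
Qed.

Lemma agreeP m i j : agree m i j -> forall k, (k < m)%N ->
  nth_edge (iter k.+1 next j) = nth_edge (iter k.+1 next i).
Proof.
elim: m i j => [//|m IH] i j; rewrite [agree _ _ _]/= => /andP[/eqP ij /IH agr].
by case=> [//|k] km; rewrite 2!(iterSr k.+1) agr.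
Qed.

Lemma agree_refl m i : agree m i i.
Proof. by elim: m i => //= m IH i; rewrite eqxx IH. Qed.

Lemma iter_plen_next i : iter n next i = i.
Proof. by rewrite -iter_next_mod modnn. Qed.

Lemma agree_full_turn i j : agree n i j = (i == j).
Proof.
apply/idP/eqP => [agr|->]; last exact: agree_refl.
apply: primitive_aperiodic => // m.
have n0 : (0 < n)%N by apply: leq_ltn_trans (ltn_ord i).
rewrite -(iter_next_mod i) -(iter_next_mod j).
have := ltn_pmod m n0; case: (m %% n)%N => [_|k kn]; last first.
  by rewrite (agreeP agr)// ltnW.
have := @agreeP n i j agr n.-1; rewrite ltn_predL => /(_ n0).
by rewrite prednK// !iter_plen_next.
Qed.

Lemma walk_mx_full_turn i :
  walk_mx i n = phase lambda mu i n *: delta_mx i i.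
Proof.
apply/matrixP => j l; rewrite walk_mxE !mxE agree_full_turn iter_plen_next.
rewrite [i == j]eq_sym; have [->|] := eqVneq j i; last by rewrite mulr0.
by case: eqP; rewrite ?mulr1 ?mulr0.
Qed.

Lemma delta_mx_pi_L i l :
  delta_mx i l *m pi_L w lambda mu (nth_edge (next l)) =
  step lambda mu (next l) *: delta_mx i (next l).
Proof.
apply/matrixP => a b; rewrite !mxE (bigD1 l)//= big1 ?addr0 => [|k /negbTE kl].
  rewrite mxE eqxx andbT pi_LE.
  have [->|] := eqVneq b (next l); last by rewrite andbF !mulr0.
  by rewrite !eqxx andbT /= mulrC andbT.
by rewrite mxE kl andbF mul0r.
Qed.

(** Full turns give the diagonal units, and the edges after them the others. The
    identity is not assumed to be in B, whence the products of positive length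
    only. *)
Theorem pi_L_generate (B : set 'M[R[i]]_n) :
  B 0 -> (forall M M', B M -> B M' -> B (M + M')) ->
  (forall c M, B M -> B (c *: M)) ->
  (forall M M', B M -> B M' -> B (M *m M')) ->
  (forall e, B (pi_L w lambda mu e)) -> forall M, B M.
Proof.
move=> B0 BD BZ BM BL M.
have Bwalk i m : B (walk_mx i m.+1).
  elim: m i => [|m IH] i; first by rewrite /= mulmx1.
  by apply: BM (IH _).
have Bii i : B (delta_mx i i).
  have n0 : (0 < n)%N by apply: leq_ltn_trans (ltn_ord i).
  have -> : delta_mx i i = (phase lambda mu i n)^-1 *: walk_mx i n.
    by rewrite walk_mx_full_turn scalerA mulVf ?scale1r// phase_neq0.
  by apply: BZ; rewrite -(prednK n0).
have Bi i m : B (delta_mx i (iter m next i)).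
  elim: m => [//|m IH]; set l := iter m next i in IH *.
  have -> : delta_mx i (iter m.+1 next i) = (step lambda mu (next l))^-1 *:
      (delta_mx i l *m pi_L w lambda mu (nth_edge (next l))).
    by rewrite delta_mx_pi_L scalerA mulVf ?scale1r// step_neq0.
  exact/BZ/BM.
have Bij i j : B (delta_mx i j).
  suff -> : j = iter (j + (n - i)) next i by [].
  apply: val_inj; rewrite val_iter_next addnCA subnKC ?(ltnW (ltn_ord i))//.
  by rewrite modnDr modn_small.
rewrite (matrix_sum_delta M); apply: big_ind => // i _.
by apply: big_ind => // j _; exact: BZ.
Qed.

End Surjectivity.

(* For lambda <> 0 the formulas are multiplicative only if w is a cycle: the
   matrix of L_(e_1) has a non-zero entry in position (n, 1), whereas
   L_(e_1) = P_(r(e_1)) L_(e_1) and row n belongs to the vertex s(e_n). *)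
Theorem proposition3p1 (R : realType) (Q : digraph) (w : fpath Q)
    (lambda mu : R[i]) :
  `|lambda| <= 1 -> `|mu| = 1 -> is_cycle w \/ lambda = 0 ->
  exists phi : (fock R Q -> fock R Q) -> 'M[R[i]]_(plen w),
    [/\ cc_representation (tensor_alg R Q) phi,
        forall v, phi (P_ R v) = pi_P R w v,
        forall e, phi (L_ R e) = pi_L w lambda mu e
      & is_cycle w -> primitive w -> lambda != 0 ->
        forall M : 'M[R[i]]_(plen w), exists2 T, tensor_alg R Q T & phi T = M].
Proof.
move=> lambda_le1 mu1 cyc.
have r1 : normc lambda <= 1 by rewrite -lecR.
have m1 : normc mu = 1 by apply: (@complexI R); exact: mu1.
have cl : lambda != 0 -> closed_up w.
  by case: cyc => [/is_cycle_closed_up//|->]; rewrite eqxx.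
have [phi [cc phiP phiL]] := walk_representation r1 m1 cl.
exists phi; split=> // _ prim lambda0 M.
have mu0 : mu != 0 by rewrite -normr_eq0 mu1 oner_eq0.
suff [T genT <-] : exists2 T, gen_alg T & phi T = M.
  by exists T => //; exact: gen_alg_tensor.
move: M; apply: (pi_L_generate lambda0 mu0 prim).
- exists 0; first exact: gen_0.
  have := repZ cc 0 (gen_alg_tensor (gen_0 R Q)).
  by rewrite !scale0r.
- move=> _ _ [S genS <-] [T genT <-]; exists (S + T); first exact: gen_add.
  by apply: (repD cc); exact: gen_alg_tensor.
- move=> c _ [S genS <-]; exists (c *: S); first exact: gen_scale.
  by apply: (repZ cc); exact: gen_alg_tensor.
- move=> _ _ [S genS <-] [T genT <-]; exists (S \o T); first exact: gen_comp.
  by apply: (repM cc); exact: gen_alg_tensor.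
- by move=> e; exists (L_ R e); first exact: gen_L.
Qed.
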